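(* Let $\epsilon\in(0,2)$ and let $\mathcal{L}^2=L^2(-\pi,\pi)$. Define the following operators in $\mathcal{L}^2$: (i) $L$: $(Ly)(x)=\epsilon\,(\sin(x)\,y'(x))'+y'(x)$, with domain $\mathfrak{D}(L)$ consisting of all absolutely continuous $2\pi$-periodic functions $y$ (i.e. $y(-\pi)=y(\pi)$) for which $\sin(x)y'(x)$ is locally absolutely continuous, so that the expression $(Ly)(x)$ is defined, and $(Ly)(x)\in\mathcal{L}^2$; (ii) $S$: $(Sy)(x)=y'(x)$, with domain consisting of all absolutely continuous $y$ on $[-\pi,\pi]$ with $y'\in\mathcal{L}^2$ and $y(-\pi)=y(\pi)$; (iii) $M$: $(My)(x)=\epsilon\,(\sin(x)\,y(x))'+y(x)$, with domain consisting of all $y\in\mathcal{L}^2$ for which $\sin(x)y(x)$ is absolutely continuous and $(My)(x)\in\mathcal{L}^2$. Then $L=MS$, where $MS$ is the operator product with domain $\{y\in\mathfrak{D}(S): Sy\in\mathfrak{D}(M)\}$; in particular $\mathfrak{D}(L)=\mathfrak{D}(MS)$.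
   Context: All functions are complex-valued on $(-\pi,\pi)$; $\mathcal{L}^2$ is the standard Lebesgue space on $(-\pi,\pi)$. Equality of unbounded operators means equality of domains and of actions. *)

(* Defs.v *)
From HB Require Import structures.
From mathcomp Require Import all_boot all_order all_algebra.
From mathcomp Require Import all_classical all_reals all_analysis.
Set Implicit Arguments. Unset Strict Implicit. Unset Printing Implicit Defensive.
Import Order.TTheory GRing.Theory Num.Theory.
Import numFieldNormedType.Exports.
Local Open Scope classical_set_scope.
Local Open Scope ring_scope.

Record cfun (R : realType) := CFun { cre : R -> R ; cim : R -> R }.

Section Defs.
Variable R : realType.
Local Notation mu := (@lebesgue_measure R).

Definition Ipi : set R := `]- pi, pi[%classic.

Definition abs_cont (a b : R) (f : R -> R) : Prop :=
  forall e : R, 0 < e -> exists2 d : R, 0 < d &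
    forall (n : nat) (ab : 'I_n -> R * R),
      (forall i, a <= (ab i).1 /\ (ab i).1 <= (ab i).2 /\ (ab i).2 <= b) ->
      (forall i j, i != j -> (ab i).2 <= (ab j).1 \/ (ab j).2 <= (ab i).1) ->
      \sum_(i < n) ((ab i).2 - (ab i).1) < d ->
      \sum_(i < n) `|f (ab i).2 - f (ab i).1| < e.

Definition cabs_cont (a b : R) (f : cfun R) : Prop :=
  abs_cont a b (cre f) /\ abs_cont a b (cim f).

Definition cloc_abs_cont_Ipi (f : cfun R) : Prop :=
  forall a b : R, - pi < a -> a < b -> b < pi -> cabs_cont a b f.

(* pointwise derivative (meaningful a.e. for absolutely continuous f) *)
Definition cderiv (f : cfun R) : cfun R :=
  CFun (derive1 (cre f)) (derive1 (cim f)).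

Definition cmulr (c : R -> R) (f : cfun R) : cfun R :=
  CFun (fun x => c x * cre f x) (fun x => c x * cim f x).

Definition cscale (k : R) (f : cfun R) : cfun R :=
  CFun (fun x => k * cre f x) (fun x => k * cim f x).

Definition cadd (f g : cfun R) : cfun R :=
  CFun (fun x => cre f x + cre g x) (fun x => cim f x + cim g x).

Definition ae_eq_Ipi (f g : cfun R) : Prop :=
  {ae mu, forall x, Ipi x -> cre f x = cre g x} /\
  {ae mu, forall x, Ipi x -> cim f x = cim g x}.

Definition L2 (f : cfun R) : Prop :=
  measurable_fun Ipi (cre f) /\ measurable_fun Ipi (cim f) /\
  (\int[mu]_(x in Ipi) ((cre f x) ^+ 2 + (cim f x) ^+ 2)%:E < +oo)%E.

Definition cperiodic (f : cfun R) : Prop :=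
  cre f (- pi) = cre f pi /\ cim f (- pi) = cim f pi.

(* Operators in L^2 are given by their graphs: [graph_T y g] means that
   (the class of) y lies in the domain of T and T y = g in L^2.
   All graphs are invariant under a.e. modification of y and g. *)

Definition graph_S (y g : cfun R) : Prop :=
  L2 y /\ L2 g /\
  exists z : cfun R, ae_eq_Ipi z y /\ cabs_cont (- pi) pi z /\
    cperiodic z /\ ae_eq_Ipi (cderiv z) g.

Definition graph_M (eps : R) (y g : cfun R) : Prop :=
  L2 y /\ L2 g /\
  exists w : cfun R, cabs_cont (- pi) pi w /\ ae_eq_Ipi w (cmulr sin y) /\
    ae_eq_Ipi g (cadd (cscale eps (cderiv w)) y).

Definition graph_L (eps : R) (y g : cfun R) : Prop :=
  L2 y /\ L2 g /\
  exists z : cfun R, ae_eq_Ipi z y /\ cabs_cont (- pi) pi z /\ cperiodic z /\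
    exists w : cfun R, cloc_abs_cont_Ipi w /\
      ae_eq_Ipi w (cmulr sin (cderiv z)) /\
      ae_eq_Ipi g (cadd (cscale eps (cderiv w)) (cderiv z)).

Definition graph_MS (eps : R) (y g : cfun R) : Prop :=
  exists h : cfun R, graph_S y h /\ graph_M eps h g.

End Defs.

(* Main.v *)
(**
  With h := w / sin, the equation defining L becomes the singular first order
  equation g = eps w' + h, w = sin h; everything amounts to showing h in L^2,
  for then w' = (g - h) / eps is integrable on (-pi, pi) and w extends to an
  absolutely continuous function on [-pi, pi].

  First, w(0) = 0: otherwise z' = w / sin has size c / x near 0, and
  z(2x) - z(x) would not tend to 0.  Next, the derivative of w^2 is
  (2 / eps) sin (h g - h^2) <= sin g^2 / (2 eps) on (0, pi), whence
  w(x)^2 / sin x <= |g|^2 / (2 eps) for 0 < x <= pi / 2.  Finally, the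
  derivative of w^2 / sin is (2 / eps) h (g - h) - h^2 cos, at most
  g^2 / (eps c) - (c / eps) h^2 for c = 1 - eps / 2 > 0; this is where
  eps < 2 is used.  Integrating, the boundary term at the point close to pi
  has the good sign and the one close to 0 is bounded by the previous step, so
  the integral of h^2 is finite.  The interval (-pi, 0) is similar.

  The fundamental theorem of calculus for absolutely continuous functions is
  obtained from the decomposition through the total variation, the
  Radon-Nikodym density of the Stieltjes measure of a nondecreasing absolutely
  continuous function, and Lebesgue differentiation.
*)
Require Import Defs.
From HB Require Import structures.
From mathcomp Require Import all_boot all_order all_algebra.
From mathcomp Require Import all_classical all_reals all_analysis.
From mathcomp Require Import measurable_realfun ring lra.
Set Implicit Arguments.
Unset Strict Implicit.
Unset Printing Implicit Defensive.
Import Order.TTheory GRing.Theory Num.Theory.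
Import numFieldNormedType.Exports.
Local Open Scope ring_scope.

(** * Absolutely continuous functions and their densities *)

Section absolute_continuity_families.
Context {R : realType}.
Implicit Types (a b : R) (f g : R -> R) (p q : R * R) (s t : seq (R * R)).

Definition subitv a b p := [&& a <= p.1, p.1 <= p.2 & p.2 <= b].
Definition apart p q := (p.2 <= q.1) || (q.2 <= p.1).
Definition total_length s := \sum_(p <- s) (p.2 - p.1).
Definition oscillation f s := \sum_(p <- s) `|f p.2 - f p.1|.

(** Lists, unlike families indexed by ['I_n], can be concatenated and refined by induction, which
    the total variation arguments require. *)
Lemma abs_contP a b f : abs_cont a b f <->
  forall e, 0 < e -> exists2 d, 0 < d & forall s, all (subitv a b) s ->
    pairwise apart s -> total_length s < d -> oscillation f s < e.
Proof.
split=> acf e e0; have [d d0 df] := acf e e0; exists d => //.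
- move=> s /allP sab /(pairwiseP (0, 0)) sp.
  rewrite /total_length big_tnth => sd; rewrite /oscillation big_tnth.
  apply: (df (size s) (tnth (in_tuple s))).
  + by move=> i; have /and3P[] := sab _ (mem_tnth i (in_tuple s)).
  + move=> i j ij; rewrite !(tnth_nth (0, 0)) /=.
    have [lij|lji|/val_inj eij] := ltngtP i j; last by rewrite eij eqxx in ij.
      by have /orP := sp i j (ltn_ord i) (ltn_ord j) lij.
    have /orP[] := sp j i (ltn_ord j) (ltn_ord i) lji; first by right.
    by left.
  + exact: sd.
- move=> n ab abP abd nd.
  have sumE (F : R * R -> R) :
      \sum_(p <- [seq ab i | i <- enum 'I_n]) F p = \sum_(i < n) F (ab i).
    by rewrite big_map big_enum.
  have := df [seq ab i | i <- enum 'I_n].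
  rewrite /oscillation /total_length !sumE; apply => //.
    apply/allP => _ /mapP[i _ ->]; apply/and3P.
    by have [? [? ?]] := abP i.
  rewrite pairwise_map.
  case: n ab abP abd nd {sumE} => [|n] ab abP abd nd.
    by have -> : enum 'I_0 = [::] by apply/size0nil; rewrite size_enum_ord.
  apply/(pairwiseP ord0) => i j; rewrite !inE size_enum_ord => ni nj ij /=.
  apply/orP/abd; rewrite -val_eqE /= !nth_enum_ord //.
  by rewrite neq_ltn ij.
Qed.

Lemma abs_contS a b c d f : a <= c -> d <= b -> abs_cont a b f -> abs_cont c d f.
Proof.
move=> ac db acf e e0; have [r r0 rf] := acf e e0; exists r => // n ab abP.
apply: rf => i; have [? [? ?]] := abP i.
by split; [apply: le_trans ac _|split => //; apply: le_trans db].
Qed.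

Lemma abs_cont_le a b f e : abs_cont a b f -> 0 < e ->
  exists2 d, 0 < d & forall x y, a <= x -> x <= y -> y <= b -> y - x < d ->
    `|f y - f x| < e.
Proof.
move=> acf e0; have [d d0 df] := acf e e0; exists d => // x y ax xy yb yxd.
have := df 1%N (fun=> (x, y)); rewrite !big_ord1 /=; apply => //.
by move=> i j; rewrite !ord1.
Qed.

Lemma abs_contN a b f : abs_cont a b f -> abs_cont a b (\- f).
Proof.
move=> acf e e0; have [d d0 df] := acf e e0; exists d => // n ab abP abd abl.
have := df n ab abP abd abl; congr (_ < _); apply: eq_bigr => i _ /=.
by rewrite -opprD normrN.
Qed.

Lemma abs_contD a b f g : abs_cont a b f -> abs_cont a b g ->
  abs_cont a b (f \+ g).
Proof.
move=> acf acg e e0; have e2 : 0 < e / 2 by rewrite divr_gt0.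
have [d d0 df] := acf _ e2; have [d' d'0 dg] := acg _ e2.
exists (Num.min d d'); first by rewrite lt_min d0.
move=> n ab abP abd; rewrite lt_min => /andP[abl abl'].
have := ltrD (df n ab abP abd abl) (dg n ab abP abd abl').
rewrite -splitr; apply: le_lt_trans; rewrite -big_split; apply: ler_sum => i _ /=.
by rewrite opprD addrACA ler_normD.
Qed.

(** A comparison principle: closure under absolute value, product and inverse, and the Lipschitz
    criterion, all reduce to an estimate on single increments. *)
Lemma abs_cont_dominated a b f g h K : 0 <= K ->
  (forall x y, a <= x -> x <= y -> y <= b ->
     `|h y - h x| <= K * (`|f y - f x| + `|g y - g x|)) ->
  abs_cont a b f -> abs_cont a b g -> abs_cont a b h.
Proof.
move=> K0 hK acf acg e e0.
(* The divisor [K + 1] instead of [K] stays positive when [K = 0]. *)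
have e2 : 0 < e / 2 / (K + 1) by rewrite !divr_gt0 // ltr_wpDl.
have [d d0 df] := acf _ e2; have [d' d'0 dg] := acg _ e2.
exists (Num.min d d'); first by rewrite lt_min d0.
move=> n ab abP abd; rewrite lt_min => /andP[abl abl'].
have := ltrD (df n ab abP abd abl) (dg n ab abP abd abl').
rewrite -mulrDl -splitr ltr_pdivlMr ?ltr_wpDl //; apply: le_lt_trans.
rewrite -big_split /= mulrC mulr_sumr; apply: ler_sum => i _ /=.
have [? [? ?]] := abP i; apply: le_trans (hK _ _ _ _ _) _ => //.
by rewrite ler_wpM2r ?addr_ge0 // lerDl.
Qed.

Lemma abs_cont_lip a b f K : 0 <= K ->
  (forall x y, a <= x -> x <= y -> y <= b -> `|f y - f x| <= K * (y - x)) ->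
  abs_cont a b f.
Proof.
move=> K0 fK.
have acid : abs_cont a b (id : R -> R).
  move=> e e0; exists e => // n ab abP abd; apply: le_lt_trans.
  apply: ler_sum => i _; have [? [? ?]] := abP i.
  by rewrite ger0_norm // subr_ge0.
apply: (@abs_cont_dominated _ _ id id _ K) => // x y ax xy yb.
apply: le_trans (fK _ _ ax xy yb) _; rewrite ler_wpM2l //.
by rewrite ger0_norm ?subr_ge0 // lerDl subr_ge0.
Qed.

Lemma abs_cont_within a b f : abs_cont a b f ->
  {within `[a, b], continuous f}%classic.
Proof.
move=> acf; apply/subspace_continuousP => x; rewrite /= in_itv /= => /andP[ax xb].
apply/cvgrPdist_lt => e e0; have [d d0 fd] := abs_cont_le acf e0.
rewrite near_withinE; near=> y => /=; rewrite in_itv /= => /andP[ay yb].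
have : `|x - y| < d by near: y; exact: cvgr_dist_lt.
have [xy|yx] := leP x y.
  by rewrite distrC ger0_norm ?subr_ge0 // => yxd; rewrite distrC; apply: fd.
by rewrite ger0_norm ?subr_ge0 ?(ltW yx) // => yxd; apply: fd => //; exact: ltW.
Unshelve. all: by end_near. Qed.

End absolute_continuity_families.

(** * Total variation and the decomposition into nondecreasing parts *)

Section absolute_continuity_total_variation.
Context {R : realType}.
Implicit Types (a b : R) (f g : R -> R) (p q : R * R) (s t : seq (R * R)).
Local Notation TV := total_variation.
Local Notation BV := bounded_variation.

Lemma subitv_trans a b p q : subitv a b p -> subitv p.1 p.2 q -> subitv a b q.
Proof.
move=> /and3P[ap _ pb] /and3P[pq qq qp]; apply/and3P; split => //.
  exact: le_trans pq.
exact: le_trans pb.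
Qed.

Lemma family_of_partition x y f (r : seq R) : itv_partition x y r ->
  exists t, [/\ all (subitv x y) t, pairwise apart t, total_length t = y - x &
    oscillation f t = variation x y f r].
Proof.
rewrite /total_length /oscillation.
elim: r x => [x /itv_partition_nil ->|h r ih x xyr].
  by exists [::]; rewrite !big_nil variation_nil subrr.
have xh : x <= h by case: xyr => /= /andP[/ltW].
have hyr := itv_partition_cons xyr; have hy := itv_partition_le hyr.
have [t [tP tA tL tO]] := ih _ hyr; exists ((x, h) :: t); split.
- rewrite /= /subitv /= lexx xh hy /=; apply: sub_all tP => q /and3P[hq -> ->].
  by rewrite (le_trans xh hq).
- rewrite /= tA andbT; apply: sub_all tP => q /and3P[hq _ _].
  by rewrite /apart hq.
- by rewrite big_cons tL /=; ring.
- by rewrite big_cons tO /variation /= big_nat_recl.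
Qed.

Lemma total_variation_family x y f eta : x <= y -> BV x y f -> 0 < eta ->
  exists t, [/\ all (subitv x y) t, pairwise apart t, total_length t = y - x &
    fine (TV x y f) <= oscillation f t + eta].
Proof.
move=> xy /(bounded_variationP _ xy) TVfin eta0.
have [_ [_ [r xyr <-] <-]] := ub_ereal_sup_adherent eta0 TVfin.
rewrite -[ereal_sup _]/(TV x y f) -(fineK TVfin) -EFinB lte_fin ltrBlDr => lt.
have [t [tP tA tL tO]] := family_of_partition f xyr.
by exists t; split => //; rewrite tO ltW.
Qed.

(** Each interval of [s] is cut along a partition that attains its variation up to [eta]. The total
    length is unchanged, so the [d] of absolute continuity still serves. The last clause carries the
    induction: pieces of intervals lying apart lie apart. *)
Lemma total_variation_refine a b f eta s : BV a b f -> 0 < eta ->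
  all (subitv a b) s -> pairwise apart s ->
  exists t, [/\ all (subitv a b) t, pairwise apart t,
    total_length t = total_length s,
    \sum_(p <- s) fine (TV p.1 p.2 f) <= oscillation f t + eta *+ size s &
    forall q, q \in t -> exists2 p, p \in s & subitv p.1 p.2 q].
Proof.
move=> abf eta0; elim: s => [_ _|p s ih /= /andP[pab sab] /andP[pA sA]].
  by exists [::]; rewrite /oscillation /total_length !big_nil addr0.
have [t [tab tA tL tO ts]] := ih sab sA.
have /and3P[ap pp pb] := pab.
have pf : BV p.1 p.2 f.
  exact: bounded_variationl pp pb (bounded_variationr ap (le_trans pp pb) abf).
have [u [up uA uL uO]] := total_variation_family pp pf eta0.
exists (u ++ t); split.
- rewrite all_cat tab andbT; apply: sub_all up => q; exact: subitv_trans.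
- rewrite pairwise_cat uA tA !andbT; apply/allrelP => q q' /(allP up) pq.
  move=> /ts[p' p's p'q']; have := allP pA _ p's.
  have /and3P[? _ ?] := pq; have /and3P[? _ ?] := p'q'.
  by move=> /orP[pp'|p'p]; apply/orP; [left|right]; lra.
- by rewrite /total_length big_cat big_cons -!/(total_length _) tL uL.
- rewrite /oscillation big_cat big_cons -!/(oscillation _ _) mulrS.
  by rewrite addrACA lerD.
- move=> q; rewrite mem_cat => /orP[qu|/ts[p' p's p'q]].
    by exists p; rewrite ?mem_head //; exact: (allP up).
  by exists p' => //; rewrite inE p's orbT.
Qed.

(** With [d] associated to the tolerance 1, every subinterval shorter than [d] has variation at most
    1, and finitely many of them make up [[a, b]]. *)
Lemma abs_cont_bounded_variation a b f : a <= b -> abs_cont a b f -> BV a b f.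
Proof.
move=> ab /abs_contP/(_ 1 ltr01)[d d0 fd].
have small x y : a <= x -> x <= y -> y <= b -> y - x < d ->
    TV x y f \is a fin_num.
  move=> ax xy yb yxd; apply/(bounded_variationP _ xy); exists 1 => _ [r xyr <-].
  have [t [tP tA tL <-]] := family_of_partition f xyr.
  apply/ltW/fd; rewrite ?tL //; apply: sub_all tP => q.
  by apply: (@subitv_trans _ _ (x, y)); rewrite /subitv /= ax xy.
apply/(bounded_variationP _ ab).
have [n] : exists n : nat, b - a <= (d / 2) *+ n.
  exists (Num.bound ((b - a) / (d / 2))).
  rewrite -mulr_natl -ler_pdivrMr ?divr_gt0 //; apply/ltW/archi_boundP.
  by rewrite divr_ge0 ?subr_ge0 ?divr_ge0 // ltW.
elim: n b ab fd small => [|n ih] b ab fd small bn.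
  by apply: small => //; rewrite mulr0n in bn; lra.
(* A last piece of length at most [d / 2] is cut off; the maximum keeps the cut inside [[a, b]]. *)
pose c := Num.max a (b - d / 2).
have ac : a <= c by rewrite le_max lexx.
have cb : c <= b by rewrite ge_max ab /=; lra.
rewrite (total_variationD f ac cb) fin_numD; apply/andP; split.
  apply: ih => //.
  - move=> s sP; apply: fd; apply: sub_all sP => q /and3P[aq qq qc].
    by rewrite /subitv aq qq (le_trans qc cb).
  - by move=> x y ax xy yc; apply: small => //; exact: le_trans cb.
  - have n0 : 0 <= d / 2 *+ n by rewrite mulrn_wge0 // divr_ge0 // ltW.
    rewrite mulrS in bn; rewrite /c.
    move: (d / 2 *+ n) bn n0 => r bn r0; case: (leP a (b - d / 2)) => _; lra.
apply: small => //.
have : b - d / 2 <= c by rewrite le_max lexx orbT.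
lra.
Qed.

Lemma total_variation_increment a b f x y : abs_cont a b f ->
  a <= x -> x <= y -> y <= b ->
  fine (TV a y f) - fine (TV a x f) = fine (TV x y f).
Proof.
move=> acf ax xy yb.
have fin z z' : a <= z -> z <= z' -> z' <= b -> TV z z' f \is a fin_num.
  move=> az zz' z'b; apply/(bounded_variationP _ zz').
  by apply: abs_cont_bounded_variation => //; exact: abs_contS acf.
rewrite (total_variationD f ax xy) fineD ?fin //.
- by rewrite addrC addKr.
- by rewrite (le_trans xy).
Qed.

(** The increment of the variation function over an interval is the variation of [f] there, which
    refinement approximates by an oscillation of [f] over a family of the same total length. *)
Lemma abs_cont_total_variation a b f : a <= b -> abs_cont a b f ->
  abs_cont a b (fun x => fine (TV a x f)).
Proof.
move=> ab acf; have abf := abs_cont_bounded_variation ab acf.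
apply/abs_contP => e e0; have e2 : 0 < e / 2 by rewrite divr_gt0.
have /abs_contP/(_ _ e2)[d d0 fd] := acf; exists d => // s sab sA sd.
(* One such error per interval of [s] adds up to at most [e / 2]; the successor covers the empty
   family. *)
have eta0 : 0 < e / 2 / (size s).+1%:R by rewrite !divr_gt0.
have [t [tab tA tL tO _]] := total_variation_refine abf eta0 sab sA.
rewrite /oscillation (eq_big_seq (fun p => fine (TV p.1 p.2 f))).
  apply: le_lt_trans tO _.
  rewrite [ltRHS]splitr ltr_leD ?fd ?tL // -[_ *+ size s]mulr_natr mulrAC ler_pdivrMr //.
  by rewrite ler_pM2l // ler_nat.
move=> p /(allP sab)/and3P[ap pp pb].
by rewrite (total_variation_increment acf) // ger0_norm // fine_ge0 // total_variation_ge0.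
Qed.

Lemma abs_cont_nondecreasing_decomp a b f : a <= b -> abs_cont a b f ->
  exists g h, [/\ abs_cont a b g, abs_cont a b h,
    {in `[a, b] &, {homo g : x y / x <= y}},
    {in `[a, b] &, {homo h : x y / x <= y}} & f = g \- h].
Proof.
move=> ab acf; pose T x := fine (TV a x f).
have acT : abs_cont a b T by exact: abs_cont_total_variation.
have TE x y : a <= x -> x <= y -> y <= b -> `|f y - f x| <= T y - T x.
  move=> ax xy yb; rewrite (total_variation_increment acf) //.
  rewrite -lee_fin fineK ?total_variation_ge //.
  apply/(bounded_variationP _ xy)/abs_cont_bounded_variation => //.
  exact: abs_contS acf.
(* Jordan decomposition: [T - f] is nondecreasing because increments of [T] dominate those of [f] in
   absolute value. *)
exists T, (T \- f); split => //.
- by apply: abs_contD => //; exact: abs_contN.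
- move=> x y; rewrite !in_itv /= => /andP[ax _] /andP[_ yb] xy.
  by rewrite -subr_ge0 (le_trans _ (TE x y _ _ _)).
- move=> x y; rewrite !in_itv /= => /andP[ax _] /andP[_ yb] xy.
  have := TE x y ax xy yb; rewrite ler_norml => /andP[_]; lra.
- by apply/funext => x /=; ring.
Qed.

End absolute_continuity_total_variation.

(** * Stieltjes measures and Radon-Nikodym densities *)

Section absolute_continuity_density.
Context {R : realType}.
Implicit Types (a b : R) (f g : R -> R).
Local Notation mu := (@lebesgue_measure R).
Local Open Scope classical_set_scope.

(** Any two points of [I] span a segment inside [I], so the measure bounds the diameter and [I] has
    finite endpoints. *)
Lemma open_interval_finite_measure (I : set R) d : open I -> is_interval I ->
  (mu I < d%:E)%E -> I !=set0 -> exists l u, l < u /\ I = `]l, u[.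
Proof.
move=> oI iI Id [x0 Ix0].
have mI : measurable I by exact: open_measurable.
have d0 : 0 < d by rewrite -lte_fin (le_lt_trans _ Id).
have diam y z : I y -> I z -> z - y < d.
  move=> Iy Iz; have [zy|yz] := leP z y; first by rewrite (le_lt_trans _ d0) ?subr_le0.
  rewrite -lte_fin (le_lt_trans _ Id) //.
  have -> : (z - y)%:E = mu `[y, z].
    by rewrite lebesgue_measure_itv /= lte_fin yz.
  apply: le_measure; rewrite ?inE //= => t /=; rewrite in_itv /=.
  exact: (iI y z).
have lbI : has_lbound I.
  by exists (x0 - d) => y Iy; have := diam y x0 Iy Ix0; lra.
have ubI : has_ubound I.
  by exists (x0 + d) => y Iy; have := diam x0 y Ix0 Iy; lra.
have IE : I = `]inf I, sup I[.
  by rewrite -{1}((interior_id I).1 oI) interval_bounded_interior.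
exists (inf I), (sup I); split => //.
by move: Ix0; rewrite {1}IE /= in_itv /= => /andP[]; exact: lt_trans.
Qed.

(** The retraction of the line onto [[a, b]]. Composing with it extends a function by constants,
    which yields a Stieltjes function on the whole line. *)
Definition clamp a b x := Num.max a (Num.min x b).

Lemma clamp_itv a b x : a <= b -> a <= clamp a b x <= b.
Proof. by move=> ab; rewrite le_max lexx /= ge_max ab /= ge_min lexx orbT. Qed.

Lemma clamp_id a b x : a <= x -> x <= b -> clamp a b x = x.
Proof. by move=> ax xb; rewrite /clamp min_l // max_r. Qed.

Lemma clamp_homo a b : {homo clamp a b : x y / x <= y}.
Proof. by move=> x y xy; apply: le_max2 => //; exact: le_min2. Qed.

Lemma clamp_lip a b x y : a <= b -> x <= y ->
  clamp a b y - clamp a b x <= y - x.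
Proof.
move=> ab xy; rewrite /clamp.
have : Num.min y b - Num.min x b <= y - x.
  by case: (leP y b) => yb; case: (leP x b) => xb; lra.
move: (Num.min y b) (Num.min x b) => v u vu.
by case: (leP a v) => av; case: (leP a u) => au; lra.
Qed.

(** A null set lies in an open set [U] of measure below [d]. Absolute continuity bounds the
    Stieltjes mass of finitely many components of [U] by [e], and countable additivity passes this
    bound to [U]. *)
Lemma abs_cont_stieltjes_dominates a b f (F : cumulative R R) : a <= b ->
  abs_cont a b f -> (forall x, F x = f (clamp a b x)) ->
  lebesgue_stieltjes_measure F `<< mu.
Proof.
move=> ab acf FE; apply/null_content_dominatesP => A mA A0.
apply/eqP; rewrite eq_le measure_ge0 andbT; apply/lee_addgt0Pr => e e0.
rewrite add0e; have [d d0 fd] := acf e e0.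
have [|U [oU AU UA]] := lebesgue_regularity_outer mA _ d0.
  by rewrite [ltLHS]A0.
have mU : measurable U by exact: open_measurable.
have Ud : (mu U < d%:E)%E.
  apply: le_lt_trans UA; rewrite -[leRHS]adde0 -A0.
  apply: (@le_trans _ _ (mu ((U `\` A) `|` A))); last first.
    by apply: measureU2 => //; exact: measurableD.
  apply: le_measure; rewrite ?inE //.
    by apply: measurableU => //; exact: measurableD.
  by move=> x Ux; have [Ax|nAx] := pselect (A x); [right|left].
(* The components of [U], clamped to [[a, b]], are admissible in [abs_cont]. *)
pose I := open_disjoint_itv oU.
have tI : trivIset setT I by exact: open_disjoint_itv_trivIset.
have oI k : open (I k) by exact: open_disjoint_itv_open.
have mI k : measurable (I k) by exact: open_measurable.
have UE : U = \bigcup_k I k by exact: open_disjoint_itv_bigcup.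
have IU k : I k `<=` U by rewrite UE; exact: bigcup_sup.
(* An empty component is encoded by the degenerate pair [(a, a)], whose length and increment are
   zero. *)
have /choice[p pP] k : exists p : R * R,
    (I k = set0 /\ p = (a, a)) \/ (p.1 < p.2 /\ I k = `]p.1, p.2[).
  have [I0|/set0P Ik0] := eqVneq (I k) set0; first by exists (a, a); left.
  have [l [u [lu IE]]] := open_interval_finite_measure (oI k)
    (@open_disjoint_itv_is_interval _ _ oU k)
    (le_lt_trans (le_measure mu (mem_set (mI k)) (mem_set mU) (IU k)) Ud) Ik0.
  by exists (l, u); right.
have p12 k : (p k).1 <= (p k).2 by case: (pP k) => [[_ ->]|[/ltW]].
have mup k : mu (I k) = ((p k).2 - (p k).1)%:E.
  case: (pP k) => [[-> ->]|[pk ->]]; first by rewrite measure0 subrr.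
  by rewrite lebesgue_measure_itv /= lte_fin pk.
have nup k : (lebesgue_stieltjes_measure F (I k) <= (F (p k).2 - F (p k).1)%:E)%E.
  case: (pP k) => [[-> ->]|[pk ->]]; first by rewrite measure0 subrr.
  apply: (@le_trans _ _ (lebesgue_stieltjes_measure F `](p k).1, (p k).2])).
    by apply: le_measure; rewrite ?inE //; exact: subset_itvW.
  rewrite /lebesgue_stieltjes_measure /measure_extension measurable_mu_extE /=.
    by rewrite wlength_itv_bnd // ltW.
  exact: is_ocitv.
pose c k := (clamp a b (p k).1, clamp a b (p k).2).
have c12 k : (c k).1 <= (c k).2 by exact: clamp_homo.
have cA i j : i != j -> (c i).2 <= (c j).1 \/ (c j).2 <= (c i).1.
  move=> ij; case: (pP i) => [[_ pi]|[pi Ii]].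
    by left; rewrite /c pi /= clamp_id //; have /andP[] := clamp_itv (p j).1 ab.
  case: (pP j) => [[_ pj]|[pj Ij]].
    by right; rewrite /c pj /= clamp_id //; have /andP[] := clamp_itv (p i).1 ab.
  have [ij2|ji1] := leP (p i).2 (p j).1; first by left; exact: clamp_homo.
  have [ji2|ij1] := leP (p j).2 (p i).1; first by right; exact: clamp_homo.
  (* Otherwise the two components overlap in []l, u[], whose midpoint contradicts their
     disjointness. *)
  pose l := Num.max (p i).1 (p j).1; pose u := Num.min (p i).2 (p j).2.
  have lu : l < u by rewrite gt_max !lt_min pi pj ji1 ij1.
  have /trivIsetP/(_ i j Logic.I Logic.I ij) := tI.
  move=> /seteqP[+ _] => /(_ ((l + u) / 2)); case; rewrite Ii Ij /=.
  rewrite !in_itv /=.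
  have : (p i).1 <= l by rewrite le_max lexx.
  have : (p j).1 <= l by rewrite le_max lexx orbT.
  have : u <= (p i).2 by rewrite ge_min lexx.
  have : u <= (p j).2 by rewrite ge_min lexx orbT.
  by move=> *; split; apply/andP; split; lra.
have partial n : (\sum_(i < n) lebesgue_stieltjes_measure F (I i) <= e%:E)%E.
  apply: (@le_trans _ _ (\sum_(i < n) (F (p i).2 - F (p i).1)%:E)%E).
    by apply: lee_sum => i _.
  rewrite sumEFin lee_fin.
  have := fd n (fun i => c i); rewrite /= => cd.
  apply: le_trans (ltW (cd _ _ _)); last 3 first.
  - by move=> i; have /andP[? ?] := clamp_itv (p i).1 ab;
      have /andP[? ?] := clamp_itv (p i).2 ab; split => //; split => //; exact: c12.
  - by move=> i j ij; exact: cA.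
  - rewrite -lte_fin; apply: le_lt_trans Ud.
    apply: (@le_trans _ _ (\sum_(i < n) mu (I i))%E).
      rewrite -sumEFin; apply: lee_sum => i _.
      by rewrite mup lee_fin clamp_lip.
    rewrite -measure_bigsetU //; apply: le_measure; rewrite ?inE //.
      by apply: bigsetU_measurable => i _; exact: mI.
    by move=> x; rewrite -bigcup_mkord => -[i _ /IU].
  by apply: ler_sum => i _; rewrite !FE ler_norm.
apply: (@le_trans _ _ (lebesgue_stieltjes_measure F U)).
  by apply: le_measure; rewrite ?inE.
have cvgU : (\sum_(0 <= i < n) lebesgue_stieltjes_measure F (I i))%E @[n --> \oo]
    --> lebesgue_stieltjes_measure F (\bigcup_k I k).
  by apply: measure_semi_sigma_additive => //; rewrite -UE.
rewrite UE -(cvg_lim _ cvgU) //; apply: lime_le.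
  by apply/cvg_ex; eexists; exact: cvgU.
by apply: nearW => n; rewrite big_mkord.
Qed.

Lemma nondecreasing_abs_cont_density a b f : a < b -> abs_cont a b f ->
  {in `[a, b]%R &, {homo f : x y / x <= y}} ->
  exists2 phi : R -> R, mu.-integrable setT (EFin \o phi) &
    forall x, a <= x -> x <= b ->
      f x - f a = (\int[mu]_(t in `]a, x]) phi t)%R.
Proof.
move=> ab acf ndf; have leab := ltW ab.
pose F x := f (clamp a b x).
have ndF : {homo F : x y / x <= y}.
  move=> x y xy; apply: ndf; last exact: clamp_homo.
    by rewrite in_itv /=; exact: clamp_itv.
  by rewrite in_itv /=; exact: clamp_itv.
have rcF : right_continuous F.
  move=> x; apply/cvgrPdist_lt => e e0; have [d d0 fd] := abs_cont_le acf e0.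
  near=> y; have xy : x <= y by [].
  have /andP[? ?] := clamp_itv x leab; have /andP[? ?] := clamp_itv y leab.
  rewrite distrC; apply: fd => //; first exact: clamp_homo.
  apply: le_lt_trans (clamp_lip leab xy) _.
  by rewrite ltrBlDl; near: y; apply: nbhs_right_lt; rewrite ltrDl.
pose Fc : cumulative R R := HB.pack F (isCumulative.Build _ _ _ F ndF rcF).
pose nu0 : {measure set (measurableTypeR R) -> \bar R} :=
  lebesgue_stieltjes_measure Fc.
have nu0E x : a <= x -> x <= b -> nu0 `]a, x] = (f x - f a)%:E.
  move=> ax xb; rewrite /nu0 /= /lebesgue_stieltjes_measure /measure_extension.
  rewrite measurable_mu_extE /=; last exact: is_ocitv.
  by rewrite wlength_itv_bnd //= /F !clamp_id.
have mD : measurable (`]a, b] : set (measurableTypeR R)) by exact: measurable_itv.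
have finD : (nu0 `]a, b] < +oo)%E by rewrite nu0E // ltry.
(* Restriction to []a, b]] gives a finite measure, to which Radon-Nikodym applies. *)
pose nu : {finite_measure set (measurableTypeR R) -> \bar R} := mfrestr mD finD.
have numu : nu `<< mu.
  apply/null_content_dominatesP => A mA A0.
  have /null_content_dominatesP := @abs_cont_stieltjes_dominates a b f Fc leab acf
    (fun=> erefl).
  apply; first exact: measurableI.
  apply/eqP; rewrite eq_le measure_ge0 andbT -A0.
  by apply: le_measure; rewrite ?inE //; exact: measurableI.
have [g [g0 gfin ig gE]] := radon_nikodym_sigma_finite
  (mu := (@lebesgue_measure R : {sigma_finite_measure set (measurableTypeR R) -> \bar R})) numu.
have gK : EFin \o (fine \o g) = g by apply/funext => x /=; rewrite fineK.
exists (fine \o g); first by rewrite gK.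
move=> x ax xb; apply: EFin_inj; rewrite -nu0E // /Rintegral.
transitivity (nu `]a, x]).
  rewrite /nu /= /mfrestr /mrestr setIidl //.
  by apply: subset_itvl; rewrite bnd_simp.
rewrite gE //.
under [in RHS]eq_integral do rewrite fineK //.
rewrite fineK // -gE; last exact: measurable_itv.
by rewrite fin_num_measure //; exact: measurable_itv.
Unshelve. all: by end_near. Qed.

End absolute_continuity_density.

(** Allows almost-everywhere statements to be combined with [filterS] and [filterS2]. *)
#[local] Instance lebesgue_ae_filter (R : realType) :
  Filter (nbhs (almost_everywhere (@lebesgue_measure R))) :=
  ae_filter_ringOfSetsType _.

(** * Almost-everywhere derivatives and integral bounds on increments *)

Section fundamental_theorem_of_calculus.
Context {R : realType}.
Implicit Types (a b : R) (f g : R -> R).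
Local Notation mu := (@lebesgue_measure R).
Local Open Scope classical_set_scope.

Lemma abs_cont_density a b f : a < b -> abs_cont a b f ->
  exists2 phi : R -> R, mu.-integrable setT (EFin \o phi) &
    forall x, a <= x -> x <= b ->
      f x - f a = (\int[mu]_(t in `]a, x]) phi t)%R.
Proof.
move=> ab /(abs_cont_nondecreasing_decomp (ltW ab))[g [h [acg ach ndg ndh ->]]].
have [phi iphi phiE] := nondecreasing_abs_cont_density ab acg ndg.
have [psi ipsi psiE] := nondecreasing_abs_cont_density ab ach ndh.
exists (phi \- psi).
  rewrite (_ : EFin \o _ = (EFin \o phi) \- (EFin \o psi))%E //.
  exact: integrableB.
move=> x ax xb /=; rewrite RintegralB //; last 2 first.
- exact: integrableS iphi.
- exact: integrableS ipsi.
by rewrite -phiE // -psiE //; ring.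
Qed.

Lemma density_derive1 a b f (phi : R -> R) : mu.-integrable setT (EFin \o phi) ->
  (forall x, a <= x -> x <= b -> f x - f a = (\int[mu]_(t in `]a, x]) phi t)%R) ->
  {ae mu, forall x, a < x < b -> derivable f x 1 /\ f^`() x = phi x}.
Proof.
move=> iphi fE.
have iphiS y : mu.-integrable [set` Interval (BRight a) (BRight y)] (EFin \o phi).
  exact: integrableS iphi.
have := FTC1 iphiS (open_integrable_locally openT iphi).
apply: filterS => x + /andP[ax xb].
rewrite /= lte_fin => /(_ ax)[dG GE].
pose G y := (\int[mu]_(t in `]a, y]) phi t)%R.
(* The integral formula holds on a whole neighbourhood of [x], so [f] inherits the derivative that
   Lebesgue differentiation gives to [G]. *)
have fG : \forall y \near x, (cst (f a) + G) y = f y.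
  near=> y; rewrite /= -[RHS](subrKC (f a)) fE //.
    by apply/ltW; near: y; exact: lt_nbhsr.
  by apply/ltW; near: y; exact: lt_nbhsl.
have dc : derivable (cst (f a)) x (1 : R) by exact: derivable_cst.
have dG' : derivable (cst (f a) + G) x (1 : R) := derivableD dc dG.
have DE : 'D_1 (cst (f a) + G) x = phi x.
  by rewrite (deriveD dc dG) derive_cst add0r -GE derive1E.
split; first exact: near_eq_derivable fG dG'.
by rewrite derive1E -(near_eq_derive _ fG).
Unshelve. all: by end_near. Qed.

Lemma abs_cont_derivable a b f : a < b -> abs_cont a b f ->
  {ae mu, forall x, a < x < b -> derivable f x 1}.
Proof.
move=> ab acf; have [phi iphi phiE] := abs_cont_density ab acf.
by apply: filterS (density_derive1 iphi phiE) => x xab /xab[].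
Qed.

Lemma ae_le_Rintegral (D : set (measurableTypeR R)) (f g : R -> R) : measurable D ->
  mu.-integrable D (EFin \o f) -> mu.-integrable D (EFin \o g) ->
  {ae mu, forall x, D x -> f x <= g x} ->
  (\int[mu]_(x in D) f x <= \int[mu]_(x in D) g x)%R.
Proof.
move=> mD if_ ig fg.
(* Replacing [f] by [m], equal to it almost everywhere on [D], turns the inequality into a pointwise
   one. *)
pose m x := Num.min (f x) (g x).
have mf : measurable_fun D f by apply/measurable_EFinP; exact: measurable_int if_.
have mg : measurable_fun D g by apply/measurable_EFinP; exact: measurable_int ig.
have mm : measurable_fun D m by exact: measurable_minr.
have fm : ae_eq mu D (EFin \o f) (EFin \o m).
  by apply: filterS fg => x /[apply] fgx /=; rewrite /m min_l.
have im : mu.-integrable D (EFin \o m).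
  have := integrableD mD (integrable_norm if_) (integrable_norm ig).
  apply: le_integrable => //; first exact/measurable_EFinP.
  move=> x _ /=; rewrite lee_fin /m (ger0_norm (addr_ge0 _ _)) //.
  by case: (leP (f x) (g x)) => _; rewrite ?lerDl ?lerDr.
rewrite (_ : \int[mu]_(x in D) f x = \int[mu]_(x in D) m x)%R; last first.
  rewrite /Rintegral; congr fine; apply: ae_eq_integral => //; exact/measurable_EFinP.
by apply: le_Rintegral => // x _; rewrite /m ge_min lexx orbT.
Qed.

Lemma ae_neq (c : R) : {ae mu, forall x, x != c}.
Proof.
exists [set c]; split; first exact: measurable_set1.
  exact: lebesgue_measure_set1.
by move=> x /= /negP; rewrite negbK => /eqP.
Qed.

Lemma open_closed_ae a b (P : R -> Prop) :
  {ae mu, forall x, a < x < b -> P x} -> {ae mu, forall x, `]a, b] x -> P x}.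
Proof.
move=> Pae; apply: filterS2 Pae (ae_neq b) => x Px xb /=.
by rewrite in_itv /= => /andP[ax xlb]; apply: Px; rewrite ax lt_neqAle xb.
Qed.

(** The density of [f] equals its derivative almost everywhere, so the increment is the integral of
    the derivative. The bound is asked at points of differentiability, where the product and
    quotient rules apply. *)
Lemma abs_cont_increment_le a b f (psi : R -> R) : a < b -> abs_cont a b f ->
  mu.-integrable `]a, b] (EFin \o psi) ->
  {ae mu, forall x, a < x < b -> derivable f x 1 -> f^`() x <= psi x} ->
  f b - f a <= (\int[mu]_(t in `]a, b]) psi t)%R.
Proof.
move=> ab acf ipsi fpsi; have [phi iphi phiE] := abs_cont_density ab acf.
rewrite phiE ?lexx ?(ltW ab) //; apply: ae_le_Rintegral => //.
  exact: integrableS iphi.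
apply: open_closed_ae; apply: filterS2 fpsi (density_derive1 iphi phiE).
by move=> x + + xab => /(_ xab) + /(_ xab)[df <-]; exact.
Qed.

Lemma abs_cont_increment_ge a b f (psi : R -> R) : a < b -> abs_cont a b f ->
  mu.-integrable `]a, b] (EFin \o psi) ->
  {ae mu, forall x, a < x < b -> derivable f x 1 -> psi x <= f^`() x} ->
  (\int[mu]_(t in `]a, b]) psi t)%R <= f b - f a.
Proof.
move=> ab acf ipsi fpsi; have [phi iphi phiE] := abs_cont_density ab acf.
rewrite phiE ?lexx ?(ltW ab) //; apply: ae_le_Rintegral => //.
  exact: integrableS iphi.
apply: open_closed_ae; apply: filterS2 fpsi (density_derive1 iphi phiE).
by move=> x + + xab => /(_ xab) + /(_ xab)[df <-]; exact.
Qed.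

Lemma abs_cont_integral a b (k : R -> R) : mu.-integrable setT (EFin \o k) ->
  abs_cont a b (fun x => \int[mu]_(t in `]a, x]) k t)%R.
Proof.
move=> ik e e0; have [d [d0 kd]] := integral_normr_continuous ik e0.
exists d => // n ab abP abd abl.
have ikS (D : set (measurableTypeR R)) : measurable D -> mu.-integrable D (EFin \o k).
  by move=> mD; exact: integrableS ik.
(* Half-open intervals remain disjoint when neighbours share an endpoint. *)
pose A i : set (measurableTypeR R) := `](ab i).1, (ab i).2].
have mA i : measurable (A i) by exact: measurable_itv.
have tA : trivIset [set` index_enum 'I_n] A.
  move=> i j _ _ [x []]; rewrite /A /= !in_itv /= => /andP[ix xi] /andP[jx xj].
  by apply/eqP; apply: contraT => ij; case: (abd i j ij) => ?; exfalso; lra.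
have uI : uniq (index_enum 'I_n) by exact: index_enum_uniq.
have mk (D : set (measurableTypeR R)) : measurable D ->
    measurable_fun D (EFin \o (fun x => `|k x|)).
  move=> mD; apply/measurable_EFinP; apply: measurableT_comp => //.
  by apply/measurable_EFinP; exact: measurable_int (ikS _ mD).
have mAU : measurable (\big[setU/set0]_(i < n) A i).
  by apply: bigsetU_measurable => i _.
(* The family is treated as one set: its union has measure below [d], so the integral of the
   absolute value of [k] over it is below [e]. *)
apply: le_lt_trans (kd (\big[setU/set0]_(i < n) A i) mAU _); last first.
  apply: (@le_lt_trans _ _ (\sum_(i < n) ((ab i).2 - (ab i).1))%:E); last by rewrite lte_fin.
  rewrite -[leLHS]mul1e -(integral_cst mu mAU).
  rewrite (ge0_integral_bigsetU mu mA uI tA); [|by []|by []].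
  rewrite -sumEFin.
  under eq_bigr do rewrite (integral_cst mu (mA _)) mul1e.
  have muA i : mu (A i) = ((ab i).2 - (ab i).1)%:E.
    have [_ [ii _]] := abP i; rewrite /A lebesgue_measure_itv /= lte_fin.
    by case: ltgtP ii => // ->; rewrite subrr.
  by apply: lee_sum => i _; rewrite le_eqVlt; apply/orP; left; apply/eqP; exact: muA.
rewrite -lee_fin /Rintegral fineK; last first.
  by apply/integrable_fin_num => //; exact/integrable_norm/ikS.
rewrite (ge0_integral_bigsetU mu mA uI tA (mk _ mAU)); last first.
  by move=> x _; rewrite lee_fin.
rewrite -sumEFin; apply: lee_sum => i _; have [ai [ii ib]] := abP i.
have ik' : mu.-integrable [set` Interval (BRight a) (BRight (ab i).2)] (EFin \o k).
  by apply: ikS; exact: measurable_itv.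
have -> := @Rintegral_itvB _ k (BRight a) (BRight (ab i).2) (ab i).1 ik'
  ltac:(by rewrite bnd_simp) ltac:(by rewrite bnd_simp).
rewrite -[leRHS]fineK ?lee_fin; first by apply: le_normr_Rintegral => //; exact: ikS.
by apply/integrable_fin_num => //; exact/integrable_norm/ikS.
Qed.

End fundamental_theorem_of_calculus.

(** * Products, inverses and the sine; behaviour at the singular point 0 *)

Section absolute_continuity_algebra.
Context {R : realType}.
Implicit Types (a b : R) (f g : R -> R).
Local Notation mu := (@lebesgue_measure R).
Local Open Scope classical_set_scope.

Lemma abs_cont_norm a b f : abs_cont a b f -> abs_cont a b (fun x => `|f x|).
Proof.
move=> acf; apply: (@abs_cont_dominated _ _ _ f f _ 1) => // x y _ _ _.
rewrite mul1r; apply: le_trans (ler_dist_dist _ _) _.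
by rewrite lerDl.
Qed.

Lemma abs_cont_bounded a b f : a <= b -> abs_cont a b f ->
  exists2 M, 0 <= M & forall x, a <= x -> x <= b -> `|f x| <= M.
Proof.
move=> ab /abs_cont_norm/abs_cont_within/(EVT_max ab)[c _ fc].
by exists `|f c| => // x ax xb; apply: fc; rewrite in_itv /= ax.
Qed.

Lemma abs_contM a b f g : a <= b -> abs_cont a b f -> abs_cont a b g ->
  abs_cont a b (fun x => f x * g x).
Proof.
move=> ab acf acg; have [M M0 fM] := abs_cont_bounded ab acf.
have [N N0 gN] := abs_cont_bounded ab acg.
apply: (@abs_cont_dominated _ _ _ f g _ (M + N)) => //; first exact: addr_ge0.
move=> x y ax xy yb.
have -> : f y * g y - f x * g x = f y * (g y - g x) + g x * (f y - f x) by ring.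
apply: le_trans (ler_normD _ _) _; rewrite !normrM.
have fy := fM y (le_trans ax xy) yb; have gx := gN x ax (le_trans xy yb).
have := ler_wpM2r (normr_ge0 (g y - g x)) fy.
have := ler_wpM2r (normr_ge0 (f y - f x)) gx.
have := mulr_ge0 M0 (normr_ge0 (f y - f x)).
have := mulr_ge0 N0 (normr_ge0 (g y - g x)).
by move=> *; lra.
Qed.

(** By compactness the absolute value of [f] has a positive minimum, and inversion is Lipschitz on
    values bounded away from 0. *)
Lemma abs_contV a b f : a <= b -> abs_cont a b f ->
  (forall x, a <= x -> x <= b -> f x != 0) -> abs_cont a b (fun x => (f x)^-1).
Proof.
move=> ab acf f0.
have [c + fc] := EVT_min ab (abs_cont_within (abs_cont_norm acf)).
rewrite in_itv /= => /andP[ac cb].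
have c0 : 0 < `|f c| by rewrite normr_gt0 f0.
apply: (@abs_cont_dominated _ _ _ f f _ (`|f c| ^- 2)) => //.
move=> x y ax xy yb.
have fx0 := f0 x ax (le_trans xy yb); have fy0 := f0 y (le_trans ax xy) yb.
have -> : (f y)^-1 - (f x)^-1 = (f x - f y) / (f x * f y) by field; apply/andP.
rewrite normrM normfV normrM [leLHS]mulrC [`|f x - f y|]distrC.
apply: ler_pM => //; last by rewrite lerDl.
rewrite lef_pV2 ?posrE; last 2 first.
- by rewrite mulr_gt0 ?normr_gt0.
- by rewrite exprn_gt0.
rewrite expr2.
by apply: ler_pM => //; apply: fc; rewrite in_itv /= ?ax ?yb ?(le_trans ax xy) ?(le_trans xy yb).
Qed.

Lemma sin_lip (x y : R) : x <= y -> `|sin y - sin x| <= y - x.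
Proof.
move=> xy; have [|c _ ->] := @MVT_segment R sin cos x y xy (fun t _ => is_derive_sin t).
  exact/continuous_subspaceT/continuous_sin.
rewrite normrM [`|y - x|]ger0_norm ?subr_ge0 // ler_piMl ?subr_ge0 //.
by rewrite ler_norml cos_geN1 cos_le1.
Qed.

Lemma abs_cont_sin a b : abs_cont a b sin.
Proof.
by apply: (@abs_cont_lip _ _ _ _ 1) => // x y _ xy _; rewrite mul1r sin_lip.
Qed.

Lemma sin_ler (x : R) : 0 <= x -> sin x <= x.
Proof. by move=> /sin_lip; rewrite sin0 !subr0; apply: le_trans; exact: ler_norm. Qed.

Lemma sin_neq0 (x : R) : - pi < x < pi -> x != 0 -> sin x != 0.
Proof.
move=> /andP[lx xp]; rewrite neq_lt => /orP[x0|x0].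
  have : 0 < sin (- x) by apply: sin_gt0_pi; apply/andP; split; lra.
  by rewrite sinN oppr_gt0 => /lt_eqF ->.
by rewrite gt_eqF // sin_gt0_pi // x0.
Qed.

Lemma sin_homo (x y : R) : 0 <= x -> x <= y -> y <= pi / 2 -> sin x <= sin y.
Proof.
move=> x0 xy yp; rewrite -subr_ge0.
have [|c + ->] := @MVT_segment R sin cos x y xy (fun t _ => is_derive_sin t).
  exact/continuous_subspaceT/continuous_sin.
rewrite in_itv /= => /andP[xc cy]; rewrite mulr_ge0 ?subr_ge0 //.
have pi0 := pi_gt0 R.
by apply: cos_ge0_pihalf; apply/andP; split; lra.
Qed.

(* If [w 0 = c > 0], then [z' >= c / (4 x)] on [(x, 2 x)] for small [x], so that
   [z (2 x) - z x >= c / 4]. *)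
Lemma quotient_nonpos_at0 (z w : R -> R) :
  abs_cont (- pi) pi z ->
  (forall a b, - pi < a -> a < b -> b < pi -> abs_cont a b w) ->
  {ae mu, forall x, - pi < x < pi -> derivable z x 1 -> w x = sin x * derive1 z x} ->
  w 0 <= 0.
Proof.
move=> acz lacw wE; rewrite leNgt; apply/negP => c0; set c := w 0 in c0.
have pi2 : 2 <= pi :> R by exact: pi_ge2.
have acw : abs_cont (- 1) 1 w by apply: lacw; lra.
have c2 : 0 < c / 2 by lra.
have c4 : 0 < c / 4 by lra.
have [d d0 wd] := abs_cont_le acw c2.
have [d' d'0 zd'] := abs_cont_le acz c4.
(* A third of the minimum leaves room for the interval from [x] to [2 * x] below each of [d], [d']
   and 1. *)
pose x := Num.min (Num.min d d') 1 / 3.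
have [x0 x1 xd xd'] : [/\ 0 < x, 3 * x <= 1, 3 * x <= d & 3 * x <= d'].
  rewrite /x; split.
  - by rewrite divr_gt0 // !lt_min d0 d'0 ltr01.
  - by rewrite mulrC divfK // ge_min lexx orbT.
  - by rewrite mulrC divfK // !ge_min lexx.
  - by rewrite mulrC divfK // !ge_min lexx orbT.
have x2x : x < 2 * x by lra.
have acz' : abs_cont x (2 * x) z by apply: abs_contS acz; lra.
have muI : mu `]x, (2 * x)] = x%:E.
  by rewrite lebesgue_measure_itv /= lte_fin x2x -EFinB; congr EFin; ring.
have mI : measurable (`]x, (2 * x)] : set (measurableTypeR R)) by exact: measurable_itv.
have icst : mu.-integrable `]x, (2 * x)] (EFin \o cst (c / (4 * x))).
  apply: (measurable_bounded_integrable mI); last exact: bounded_cst.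
    by rewrite [ltLHS]muI ltry.
  exact: measurable_cst.
have := abs_cont_increment_ge x2x acz' icst.
have -> : (\int[mu]_(t in `]x, (2 * x)]) cst (c / (4 * x)) t)%R = c / 4.
  apply: (etrans (Rintegral_cst mu mI _)); apply: (etrans (congr1 _ (congr1 fine muI))).
  by rewrite /=; field; lra.
have : `|z (2 * x) - z x| < c / 4 by apply: zd'; lra.
rewrite ltr_norml => /andP[_ zx] zge.
suff : c / 4 <= z (2 * x) - z x by lra.
apply: zge; apply: filterS wE => t wt xt dz.
have /andP[xt1 xt2] := xt.
have t0 : 0 < t by lra.
have st0 : 0 < sin t by apply: sin_gt0_pi; apply/andP; split; lra.
have wc : c / 2 <= w t.
  have : `|w t - w 0| < c / 2 by apply: wd; lra.
  by rewrite ltr_norml -/c => /andP[? _]; lra.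
have wt' : w t = sin t * derive1 z t by apply: wt => //; apply/andP; split; lra.
have st := sin_ler (ltW t0).
(* Positivity of the derivative allows [sin t] to be replaced by the larger [2 * x] in the
   product. *)
have z0 : 0 < derive1 z t by rewrite -(pmulr_rgt0 _ st0) -wt'; lra.
have : sin t * derive1 z t <= 2 * x * derive1 z t by rewrite ler_pM2r //; lra.
rewrite -wt' /cst ler_pdivrMr; last by lra.
by move=> ?; lra.
Qed.

End absolute_continuity_algebra.

(** * Energy estimates for the singular equation *)

Section square_integrability.
Context {R : realType}.
Implicit Types (a b : R).
Local Notation mu := (@lebesgue_measure R).
Local Open Scope classical_set_scope.

Definition loc_abs_cont (l u : R) (f : R -> R) :=
  forall a b, l < a -> a < b -> b < u -> abs_cont a b f.

Lemma loc_abs_cont_continuous l u (f : R -> R) : loc_abs_cont l u f ->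
  {in `]l, u[%R, continuous f}.
Proof.
move=> lacf x; rewrite in_itv /= => /andP[lx xu].
have la : l < (l + x) / 2 by lra.
have ab : (l + x) / 2 < (x + u) / 2 by lra.
have bu : (x + u) / 2 < u by lra.
have [+ _ _] := (continuous_within_itvP f ab).1 (abs_cont_within (lacf _ _ la ab bu)).
by apply; rewrite in_itv /=; apply/andP; split; lra.
Qed.

Lemma loc_abs_cont_measurable l u (f : R -> R) : loc_abs_cont l u f ->
  measurable_fun `]l, u[ f.
Proof.
move=> lacf; apply: open_continuous_measurable_fun; first exact: interval_open.
by move=> x /set_mem; exact: loc_abs_cont_continuous lacf x.
Qed.

Lemma abs_cont_integrable a b (f : R -> R) : a <= b -> abs_cont a b f ->
  mu.-integrable `]a, b] (EFin \o f).
Proof.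
move=> ab acf; have mI : measurable (`]a, b] : set (measurableTypeR R)).
  exact: measurable_itv.
apply: (measurable_bounded_integrable mI).
- by rewrite [ltLHS]lebesgue_measure_itv /=; case: ifP => // _; rewrite -EFinB ltry.
- apply: measurable_funS (subspace_continuous_measurable_fun _ (abs_cont_within acf)).
  + exact: measurable_itv.
  + exact: subset_itv_oc_cc.
  + exact: measurable_itv.
- have [M M0 fM] := abs_cont_bounded ab acf.
  exists M; split; first exact: num_real.
  move=> N MN x /=; rewrite in_itv /= => /andP[ax xb].
  by apply: le_trans (fM x (ltW ax) xb) (ltW MN).
Qed.

(** Monotone convergence along intervals increasing to []l, u[]. The middle point [m] separates the
    endpoints, so later estimates can place each of them on a known side of it. *)
Lemma integral_exhaustion (l m u : R) (q : R -> R) (M : R) : l < m -> m < u ->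
  (forall x, 0 <= q x) -> measurable_fun `]l, u[ q ->
  (forall a b, l < a -> a < m -> m < b -> b < u ->
    (\int[mu]_(t in `]a, b]) (q t)%:E <= M%:E)%E) ->
  (\int[mu]_(t in `]l, u[) (q t)%:E <= M%:E)%E.
Proof.
move=> lm mlu q0 mq qM.
(* Denominators starting at 2 keep [a n < m < b n] strict from the first index on. *)
pose a n := l + (m - l) / n.+2%:R; pose b n := u - (u - m) / n.+2%:R.
pose F n : set (measurableTypeR R) := `]a n, b n].
have frac (c : R) n : 0 < c -> 0 < c / n.+2%:R < c.
  move=> c0; apply/andP; split; first by rewrite divr_gt0.
  by rewrite ltr_pdivrMr // ltr_pMr // ltr1n.
have la n : l < a n < m.
  rewrite /a; move: ((m - l) / _) (frac (m - l) n ltac:(lra)) => r /andP[? ?].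
  by apply/andP; split; lra.
have bu n : m < b n < u.
  rewrite /b; move: ((u - m) / _) (frac (u - m) n ltac:(lra)) => r /andP[? ?].
  by apply/andP; split; lra.
have fracle (c : R) n k : 0 <= c -> (n <= k)%N -> c / k.+2%:R <= c / n.+2%:R.
  by move=> c0 nk; rewrite ler_wpM2l // lef_pV2 ?posrE // ler_nat.
have FE : \bigcup_n F n = `]l, u[.
  apply/seteqP; split => [x [n _]|x] /=; rewrite /F /= !in_itv /=.
    by have := la n; have := bu n; move=> /andP[? ?] /andP[? ?] /andP[? ?];
      apply/andP; split; lra.
  move=> /andP[lx xu].
  have [n Hn] : exists n : nat, (m - l) / (x - l) <= n.+2%:R /\ (u - m) / (u - x) <= n.+2%:R.
    exists (maxn (Num.bound ((m - l) / (x - l))) (Num.bound ((u - m) / (u - x)))).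
    split.
    + apply: le_trans (ltW (archi_boundP _)) _; first by rewrite divr_ge0; lra.
      by rewrite ler_nat; apply: leq_trans (leq_maxl _ _) _; rewrite ltnW.
    + apply: le_trans (ltW (archi_boundP _)) _; first by rewrite divr_ge0; lra.
      by rewrite ler_nat; apply: leq_trans (leq_maxr _ _) _; rewrite ltnW.
  (* The bounds on [n.+2] are not strict; the next index makes them so. *)
  exists n.+1 => //=; rewrite /F /= in_itv /= /a /b.
  have small (c d : R) : 0 < c -> 0 < d -> c / d <= n.+2%:R -> c / n.+3%:R < d.
    move=> c0 d0; rewrite ler_pdivrMr // ltr_pdivrMr // => /le_lt_trans; apply.
    by rewrite mulrC ltr_pM2l // ltr_nat.
  have [h1 h2] := Hn.
  have := small (m - l) (x - l) ltac:(lra) ltac:(lra) h1.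
  have := small (u - m) (u - x) ltac:(lra) ltac:(lra) h2.
  move: ((m - l) / _) ((u - m) / _) => r r' ? ?.
  by apply/andP; split; lra.
have mF n : measurable (F n) by exact: measurable_itv.
have FS n : F n `<=` `]l, u[ by rewrite -FE; exact: bigcup_sup.
have ndF : {homo F : n k / (n <= k)%N >-> (n <= k)%O}.
  move=> n k nk; apply/subsetPset => x; rewrite /F /= !in_itv /= /a /b.
  have := fracle (m - l) n k ltac:(lra) nk.
  have := fracle (u - m) n k ltac:(lra) nk.
  move: ((m - l) / k.+2%:R) ((m - l) / n.+2%:R) => r r'.
  move: ((u - m) / k.+2%:R) ((u - m) / n.+2%:R) => s s' ? ? /andP[? ?].
  by apply/andP; split; lra.
have mqF n : measurable_fun (F n) (EFin \o q).
  by apply/measurable_EFinP; apply: measurable_funS mq => //; exact: measurable_itv.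
have cvgF := ge0_nondecreasing_set_cvg_integral (mu := mu) ndF mF mqF
  (fun _ x _ => q0 x : (0 <= (EFin \o q) x)%E).
rewrite -FE -(cvg_lim _ cvgF) //; apply: lime_le.
  by apply/cvg_ex; eexists; exact: cvgF.
apply: nearW => n; have /andP[? ?] := la n; have /andP[? ?] := bu n.
exact: qM.
Qed.

Lemma derive1_square (w : R -> R) x : derivable w x 1 ->
  derive1 (fun t => w t * w t) x = 2 * (w x * derive1 w x).
Proof.
move=> dw; rewrite derive1E (deriveM dw dw) -derive1E /GRing.scale /=; ring.
Qed.

Lemma derive1_square_div_sin (w : R -> R) x : derivable w x 1 -> sin x != 0 ->
  derive1 (fun t => w t * w t * (sin t)^-1) x =
  2 * (w x * derive1 w x) / sin x - (w x / sin x) ^+ 2 * cos x.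
Proof.
move=> dw sx0.
have dsin : derivable (@sin R) x 1 by exact: derivable_sin.
have dV : derivable (fun t => (sin t)^-1) x (1 : R) by exact: derivableV.
rewrite derive1E (deriveM (derivableM dw dw) dV) (deriveM dw dw).
rewrite (deriveV sx0 dsin) -['D_1 w x]derive1E.
have -> : 'D_1 (@sin R) x = cos x by apply: derive_val.
have -> : (w * w) x = w x * w x by [].
by rewrite /GRing.scale /=; field.
Qed.

End square_integrability.

(** * Completing the square in the two pointwise estimates *)

Section energy_algebra.
Context {R : realFieldType}.

(** Polarization: [4 * eps * d * y] is the difference of the squares of [eps * d + y] and
    [eps * d - y]. Here [y] stands for [w / sin] and [d] for the derivative of [w]. *)
Lemma square_increment_le (eps s S y d k : R) : 0 < eps -> 0 < s -> s <= S -> k = eps * d + y ->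
  2 * (s * y * d) <= S / (2 * eps) * k ^+ 2.
Proof.
move=> eps0 s0 sS ->; rewrite -subr_ge0.
have -> : S / (2 * eps) * (eps * d + y) ^+ 2 - 2 * (s * y * d) =
  ((S - s) * (eps * d + y) ^+ 2 + s * (eps * d - y) ^+ 2) / (2 * eps).
  by field; rewrite ?gt_eqF //; lra.
apply: divr_ge0; last by lra.
by apply: addr_ge0; apply: mulr_ge0; rewrite ?sqr_ge0 //; lra.
Qed.

(** After eliminating [d], the difference of the two sides is the square of [k - (1 - eps / 2) * y]
    plus a multiple of [(1 + c) * y ^+ 2], both with nonnegative coefficients. Here [c] stands for
    the cosine. *)
Lemma energy_increment_le (eps y d k c : R) : 0 < eps < 2 ->
  k = eps * d + y -> -1 <= c ->
  2 * (y * d) - y ^+ 2 * c <= k ^+ 2 / (eps * (1 - eps / 2)) - (1 - eps / 2) / eps * y ^+ 2.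
Proof.
move=> /andP[eps0 eps2] kE c1; have gap0 : 0 < 1 - eps / 2 by lra.
have dE : d = (k - y) / eps by rewrite kE; field; rewrite gt_eqF.
rewrite -subr_ge0 dE.
have -> : k ^+ 2 / (eps * (1 - eps / 2)) - (1 - eps / 2) / eps * y ^+ 2 -
    (2 * (y * ((k - y) / eps)) - y ^+ 2 * c) =
  ((k - (1 - eps / 2) * y) ^+ 2 / (1 - eps / 2) + eps * (1 + c) * y ^+ 2) / eps.
  by field; rewrite ?gt_eqF //; lra.
apply: divr_ge0; last exact: ltW.
apply: addr_ge0; first by apply: divr_ge0; [exact: sqr_ge0|exact: ltW].
by apply: mulr_ge0; [apply: mulr_ge0; lra|exact: sqr_ge0].
Qed.

End energy_algebra.

(** * Integrated estimates for [w ^+ 2] and [w ^+ 2 / sin] *)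

Section energy_estimate.
Context {R : realType} (eps : R) (w g : R -> R).
Local Notation mu := (@lebesgue_measure R).
Local Open Scope classical_set_scope.
Local Notation energy := (\int[mu]_(t in `](- pi), pi[) (g t ^+ 2))%R.
Local Notation h := (fun t : R => w t / sin t).
Local Notation gap := (1 - eps / 2).

(** The equation of [L] for one real component, with the derivative of [z] eliminated as [w / sin].
    The condition at 0 is supplied by [quotient_vanishes]. *)
Definition singular_ode := [/\ loc_abs_cont (- pi) pi w, w 0 = 0,
  mu.-integrable `](- pi), pi[ (EFin \o (fun x => g x ^+ 2)) &
  {ae mu, forall x, - pi < x < pi -> g x = eps * derive1 w x + w x / sin x}].

Let subpi a b : - pi <= a -> b < pi -> `]a, b] `<=` `](- pi : R), pi[.
Proof.
move=> pa bp x /=; rewrite !in_itv /= => /andP[ax xb].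
by rewrite (le_lt_trans pa ax) (le_lt_trans xb bp).
Qed.

Let igS a b : singular_ode -> - pi <= a -> b < pi ->
  mu.-integrable `]a, b] (EFin \o (fun x => g x ^+ 2)).
Proof. by move=> [_ _ ig _] pa bp; apply: integrableS ig => //; exact: subpi. Qed.

Let energy_le a b : singular_ode -> - pi <= a -> b < pi ->
  (\int[mu]_(t in `]a, b]) (g t ^+ 2) <= energy)%R.
Proof.
move=> so pa bp; have [_ _ ig _] := so; apply: fine_le.
- by apply: integrable_fin_num => //; exact: igS.
- exact: integrable_fin_num.
- apply: ge0_subset_integral => //; last exact: subpi.
  + exact: measurable_int ig.
  + by move=> x _; rewrite lee_fin sqr_ge0.
Qed.

(** Integrating the derivative of [w ^+ 2] from 0, where [w] vanishes, gives the bound; monotonicity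
    of the sine up to [pi / 2] replaces [sin t] by the constant [sin x]. *)
Lemma square_le_sin_right x : 0 < eps -> singular_ode -> 0 < x -> x <= pi / 2 ->
  w x ^+ 2 <= sin x * (energy / (2 * eps)).
Proof.
move=> eps0 so x0 xp; have [acw w0 ig ode] := so; have pi_2 := pi_ge2 R.
have acx : abs_cont 0 x w by apply: acw; lra.
have i2 := igS (a := 0) (b := x) so ltac:(lra) ltac:(lra).
have mI : measurable (`]0, x] : set (measurableTypeR R)) by exact: measurable_itv.
have ipsi : mu.-integrable `]0, x] (EFin \o (fun t => sin x / (2 * eps) * g t ^+ 2)).
  exact: integrableZl i2.
have sx0 : 0 < sin x by apply: sin_gt0_pi; apply/andP; split; lra.
have := abs_cont_increment_le x0 (abs_contM (ltW x0) acx acx) ipsi.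
rewrite w0 mul0r subr0 -expr2 (RintegralZl _ mI i2) => le.
apply: (@le_trans _ _ (sin x / (2 * eps) * \int[mu]_(t in `]0%R, x]) (g t ^+ 2))%R).
  apply: le; have := abs_cont_derivable x0 acx.
  move=> dw; apply: filterS2 ode dw => t odet dwt tx _.
  have /andP[t0 tx'] := tx.
  have st0 : 0 < sin t by apply: sin_gt0_pi; apply/andP; split; lra.
  rewrite derive1_square; last exact: dwt.
  have -> : w t * derive1 w t = sin t * (w t / sin t) * derive1 w t.
    by field; rewrite gt_eqF.
  apply: square_increment_le => //.
    by apply: sin_homo => //; lra.
  by apply: odet; apply/andP; split; lra.
rewrite mulrA [leRHS]mulrAC; apply: ler_wpM2l; last by apply: energy_le => //; lra.
by apply: divr_ge0; [exact: ltW|rewrite mulr_ge0 // ltW].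
Qed.

Lemma square_le_sin_left x : 0 < eps -> singular_ode -> x < 0 -> - (pi / 2) <= x ->
  w x ^+ 2 <= - sin x * (energy / (2 * eps)).
Proof.
move=> eps0 so x0 xp; have [acw w0 ig ode] := so; have pi_2 := pi_ge2 R.
have acx : abs_cont x 0 w by apply: acw; lra.
have i2 := igS (a := x) (b := 0) so ltac:(lra) ltac:(lra).
have mI : measurable (`]x, 0] : set (measurableTypeR R)) by exact: measurable_itv.
have ipsi : mu.-integrable `]x, 0] (EFin \o (fun t => sin x / (2 * eps) * g t ^+ 2)).
  exact: integrableZl i2.
have sx0 : 0 < - sin x.
  by rewrite -sinN; apply: sin_gt0_pi; apply/andP; split; lra.
have := abs_cont_increment_ge x0 (abs_contM (ltW x0) acx acx) ipsi.
rewrite w0 mul0r sub0r -expr2 (RintegralZl _ mI i2) => ge.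
rewrite -lerN2.
apply: (@le_trans _ _
  (sin x / (2 * eps) * \int[mu]_(t in `]x, 0%R]) (g t ^+ 2))%R); last first.
  apply: ge; have := abs_cont_derivable x0 acx.
  move=> dw; apply: filterS2 ode dw => t odet dwt tx _.
  have /andP[t0 tx'] := tx.
  have st0 : 0 < - sin t.
    by rewrite -sinN; apply: sin_gt0_pi; apply/andP; split; lra.
  rewrite derive1_square; last exact: dwt.
  (* Left of 0 the positive weight is [- sin t], so the same square estimate now bounds the
     derivative from below. *)
  have -> : w t * derive1 w t = - (- sin t * (w t / sin t) * derive1 w t).
    by field; rewrite -oppr_eq0 gt_eqF.
  rewrite mulrN -lerN2 opprK -mulNr -mulNr.
  apply: square_increment_le => //.
    by rewrite -!sinN; apply: sin_homo => //; lra.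
  by apply: odet; apply/andP; split; lra.
rewrite -mulNr opprK mulrA [leLHS]mulrAC.
rewrite -subr_ge0 -mulrBr -mulrNN mulr_ge0 //.
  by rewrite -mulNr; apply: divr_ge0; [exact: ltW|rewrite mulr_ge0 // ltW].
by rewrite opprB subr_ge0; apply: energy_le => //; lra.
Qed.

(** Away from 0 the function [w ^+ 2 / sin] is absolutely continuous; [energy_increment_le] bounds
    its derivative, and the negative term in that bound yields the integral on the left. *)
Lemma quotient_energy_le a b : 0 < eps < 2 -> singular_ode -> - pi < a -> a < b -> b < pi -> 0 < a \/ b < 0 ->
  gap / eps * (\int[mu]_(t in `]a, b]) (w t / sin t) ^+ 2)%R <=
  w a ^+ 2 / sin a - w b ^+ 2 / sin b + energy / (eps * gap).
Proof.
move=> /andP[eps0 eps2] so pa ab bp ab0.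
have [acw w0 ig ode] := so; have leab := ltW ab; have gap0 : 0 < gap by lra.
have sab t : a <= t -> t <= b -> sin t != 0.
  move=> at_ tb; apply: sin_neq0; first by apply/andP; split; lra.
  by case: ab0 => ?; [rewrite gt_eqF|rewrite lt_eqF]; lra.
have acab : abs_cont a b w by exact: acw.
have acV := abs_contV leab (abs_cont_sin a b) sab.
have ach : abs_cont a b h by exact: abs_contM.
have acQ : abs_cont a b (fun t => w t * w t * (sin t)^-1).
  by apply: abs_contM => //; exact: abs_contM.
have i2 := igS so (ltW pa) bp.
have mI : measurable (`]a, b] : set (measurableTypeR R)) by exact: measurable_itv.
have ih : mu.-integrable `]a, b] (EFin \o (fun t => (w t / sin t) ^+ 2)).
  have := abs_cont_integrable leab (abs_contM leab ach ach).
  by apply: eq_integrable => // t _; rewrite /= expr2.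
have ig' : mu.-integrable `]a, b] (EFin \o (fun t => (eps * gap)^-1 * g t ^+ 2)).
  exact: integrableZl i2.
have ih' : mu.-integrable `]a, b] (EFin \o (fun t => gap / eps * (w t / sin t) ^+ 2)).
  exact: integrableZl ih.
have := @abs_cont_increment_le _ a b _
  (fun t => (eps * gap)^-1 * g t ^+ 2 - gap / eps * (w t / sin t) ^+ 2) ab acQ.
rewrite RintegralB // (RintegralZl _ mI i2) (RintegralZl _ mI ih) -!expr2 => le.
suff : w b ^+ 2 / sin b - w a ^+ 2 / sin a <=
    (eps * gap)^-1 * (\int[mu]_(t in `]a, b]) (g t ^+ 2))%R -
    gap / eps * (\int[mu]_(t in `]a, b]) (w t / sin t) ^+ 2)%R.
  have : (eps * gap)^-1 * (\int[mu]_(t in `]a, b]) (g t ^+ 2))%R <= energy / (eps * gap).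
    rewrite mulrC; apply: ler_wpM2r; last by apply: energy_le => //; exact: ltW.
    by rewrite invr_ge0 mulr_ge0 // ltW.
  move: (w a ^+ 2 / sin a) (w b ^+ 2 / sin b) => A B.
  move: (_ * Rintegral _ _ _) (_ * Rintegral _ _ _) (_ / (eps * _)) => I J E.
  by move=> *; lra.
apply: le.
  rewrite (_ : EFin \o _ = (EFin \o (fun t => (eps * gap)^-1 * g t ^+ 2)%R) \-
    (EFin \o (fun t => gap / eps * (w t / sin t) ^+ 2)%R))%E //.
  exact: integrableB.
have := abs_cont_derivable ab acab.
move=> dw; apply: filterS2 ode dw => t odet dwt tab _.
have /andP[ta tb] := tab.
have st0 := sab t (ltW ta) (ltW tb).
rewrite derive1_square_div_sin //; last exact: dwt.
have -> : 2 * (w t * derive1 w t) / sin t = 2 * ((w t / sin t) * derive1 w t).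
  by field.
rewrite [_^-1 * _]mulrC; apply: energy_increment_le; [exact/andP| |exact: cos_geN1].
by apply: odet; apply/andP; split; lra.
Qed.

End energy_estimate.

(** * Square integrability of [w / sin] *)

Section square_integrable_quotient.
Context {R : realType}.
Implicit Types (eps : R) (w g : R -> R).
Local Notation mu := (@lebesgue_measure R).
Local Open Scope classical_set_scope.

Lemma quotient_abs_cont w a b : loc_abs_cont (- pi) pi w ->
  - pi < a -> a < b -> b < pi -> 0 < a \/ b < 0 ->
  abs_cont a b (fun t => w t / sin t).
Proof.
move=> acw pa ab bp ab0; have leab := ltW ab.
apply: abs_contM => //; first exact: acw.
apply: abs_contV => //; first exact: abs_cont_sin.
move=> t at_ tb; apply: sin_neq0; first by apply/andP; split; lra.
by case: ab0 => ?; [rewrite gt_eqF|rewrite lt_eqF]; lra.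
Qed.

Lemma quotient_measurable w : loc_abs_cont (- pi) pi w ->
  measurable_fun (@Ipi R : set (measurableTypeR R)) (fun t => w t / sin t).
Proof.
move=> acw; have pi0 := pi_gt0 R.
have -> : @Ipi R = `](- pi), 0%R[ `|` `[0%R, pi[ :> set R.
  by rewrite -itv_bndbnd_setU // bnd_simp; lra.
apply/measurable_funU; [exact: measurable_itv|exact: measurable_itv|split].
  apply: loc_abs_cont_measurable => a b pa ab b0.
  by apply: quotient_abs_cont => //; [lra|right].
apply/measurable_fun_itv_obnd_cbndP.
apply: loc_abs_cont_measurable => a b pa ab b0.
by apply: quotient_abs_cont => //; [lra|left].
Qed.

Lemma quotient_square_integrable eps w g : 0 < eps < 2 -> singular_ode eps w g ->
  (\int[mu]_(t in @Ipi R) ((w t / sin t) ^+ 2)%:E < +oo)%E.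
Proof.
move=> eps02 so; have [acw w0 ig _] := so; have pi_2 := pi_ge2 R.
have /andP[eps0 eps2] := eps02.
set E := (\int[mu]_(t in `](- pi), pi[) (g t ^+ 2))%R.
have gap0 : 0 < (1 - eps / 2) / eps by rewrite divr_gt0 //; lra.
(* The boundary contribution near 0 plus the energy term, divided by the coefficient of the integral
   in [quotient_energy_le]. *)
pose M := (E / (2 * eps) + E / (eps * (1 - eps / 2))) / ((1 - eps / 2) / eps).
have bound a b : - pi < a -> a < b -> b < pi -> 0 < a \/ b < 0 ->
    w a ^+ 2 / sin a - w b ^+ 2 / sin b <= E / (2 * eps) ->
    (\int[mu]_(t in `]a, b]) ((w t / sin t) ^+ 2)%:E <= M%:E)%E.
  move=> pa ab bp ab0 wab; have ach := quotient_abs_cont acw pa ab bp ab0.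
  have ih : mu.-integrable `]a, b] (EFin \o (fun t => (w t / sin t) ^+ 2)).
    have := abs_cont_integrable (ltW ab) (abs_contM (ltW ab) ach ach).
    by apply: eq_integrable => //; exact: measurable_itv.
  rewrite -[leLHS]fineK; last by apply: integrable_fin_num => //; exact: measurable_itv.
  rewrite lee_fin ler_pdivlMr // mulrC.
  apply: le_trans (quotient_energy_le eps02 so pa ab bp ab0) _.
  by rewrite lerD2r.
have mh := quotient_measurable acw.
have mh2 : measurable_fun (@Ipi R : set (measurableTypeR R)) (fun t => (w t / sin t) ^+ 2).
  exact: measurable_funX.
have subl : `](- pi), 0%R[ `<=` (@Ipi R).
  by move=> x; rewrite /Ipi /= !in_itv /= => /andP[? ?]; apply/andP; split; lra.
have subr : `[0%R, pi[ `<=` (@Ipi R).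
  by move=> x; rewrite /Ipi /= !in_itv /= => /andP[? ?]; apply/andP; split; lra.
have IE : @Ipi R = `](- pi), 0%R[ `|` `[0%R, pi[ :> set R.
  by rewrite -itv_bndbnd_setU // bnd_simp; lra.
rewrite IE ge0_integral_setU //; first last.
- apply/eqP/seteqP; split => // x [] /=; rewrite !in_itv /=.
  by move=> /andP[_ ?] /andP[? _]; lra.
- by move=> x _; rewrite lee_fin sqr_ge0.
- by rewrite -IE; exact/measurable_EFinP.
have mr : measurable_fun `]0%R, pi[ (fun t => (w t / sin t) ^+ 2).
  have sub : `]0%R, pi[ `<=` (@Ipi R).
    by move=> x /= /[!in_itv] /= /andP[/ltW x0 xp]; apply: subr; rewrite /= in_itv /= x0.
  apply: measurable_funS mh2 => //; exact: measurable_itv.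
rewrite -integral_itv_obnd_cbnd; last exact/measurable_EFinP.
apply: (@le_lt_trans _ _ (M%:E + M%:E)%E); last by rewrite -EFinD ltry.
apply: leeD.
  (* With this middle point the endpoint [b] lies in the range of [square_le_sin_left], while the
     boundary term at [a] is nonpositive because [sin a < 0]. *)
  apply: (@integral_exhaustion _ _ (- (pi / 2))); try lra.
  - by move=> x; exact: sqr_ge0.
  - apply: measurable_funS mh2 => //; exact: measurable_itv.
  move=> a b pa am mb b0; apply: bound; [exact: pa|exact: lt_trans am mb|lra|by right|].
  have := square_le_sin_left eps0 so b0 (ltW mb); rewrite -/E => le.
  have sa : sin a < 0 by rewrite -oppr_gt0 -sinN sin_gt0_pi //; apply/andP; split; lra.
  have sb : 0 < - sin b by rewrite -sinN sin_gt0_pi //; apply/andP; split; lra.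
  have wa : w a ^+ 2 / sin a <= 0.
    by rewrite mulr_ge0_le0 ?sqr_ge0 // invr_le0 ltW.
  have wb : - (w b ^+ 2 / sin b) <= E / (2 * eps).
    by rewrite -mulrN -invrN ler_pdivrMr // mulrC.
  by apply: le_trans wb; rewrite gerDr.
apply: (@integral_exhaustion _ _ (pi / 2)); try lra.
- by move=> x; exact: sqr_ge0.
- exact: mr.
move=> a b a0 am mb bp; apply: bound; [lra|exact: lt_trans am mb|exact: bp|by left|].
have := square_le_sin_right eps0 so a0 (ltW am); rewrite -/E => le.
have sa : 0 < sin a by rewrite sin_gt0_pi //; apply/andP; split; lra.
have sb : 0 < sin b by rewrite sin_gt0_pi //; apply/andP; split; lra.
have wb : 0 <= w b ^+ 2 / sin b by rewrite divr_ge0 ?sqr_ge0 // ltW.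
have wa : w a ^+ 2 / sin a <= E / (2 * eps) by rewrite ler_pdivrMr // mulrC.
by apply: le_trans wa; rewrite gerDl oppr_le0.
Qed.

End square_integrable_quotient.

(** * Vanishing at 0 and extension to the closed interval *)

Section extension.
Context {R : realType}.
Local Notation mu := (@lebesgue_measure R).
Local Open Scope classical_set_scope.

Lemma quotient_vanishes (z w : R -> R) : abs_cont (- pi) pi z ->
  loc_abs_cont (- pi) pi w ->
  {ae mu, forall x, - pi < x < pi -> w x = sin x * derive1 z x} -> w 0 = 0.
Proof.
move=> acz acw wE; apply/eqP; rewrite eq_le; apply/andP; split.
  apply: (quotient_nonpos_at0 acz acw).
  by apply: filterS wE => x wx xpi _; exact: wx.
(* The relation between [w] and [z] is linear, so the one-sided result for the opposite pair gives
   the other inequality. *)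
rewrite -oppr_le0; apply: (quotient_nonpos_at0 (z := \- z) (w := \- w)).
- exact: abs_contN.
- by move=> a b pa ab bp; apply: abs_contN; exact: acw.
apply: filterS wE => x wx xpi dz.
have dz' : derivable z x (1 : R).
  by have := derivableN dz; rewrite (_ : - (\- z) = z) //; apply/funext => t /=; exact: opprK.
have -> : derive1 (\- z) x = - derive1 z x by rewrite !derive1E; exact: deriveN.
by rewrite /= wx // mulrN.
Qed.

Lemma abs_cont_extension (l m u : R) (w k : R -> R) : l < m -> m < u ->
  loc_abs_cont l u w -> mu.-integrable `]l, u[ (EFin \o k) ->
  {ae mu, forall x, l < x < u -> derive1 w x = k x} ->
  exists2 W, abs_cont l u W & forall x, l < x < u -> W x = w x.
Proof.
move=> lm mlu acw ik wk.
have mI : measurable (`]l, u[ : set (measurableTypeR R)) by exact: measurable_itv.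
(* Extension by zero gives an integrable function on the line, whose primitive is absolutely
   continuous up to both endpoints. *)
pose K := k \_ `]l, u[.
have iK : mu.-integrable setT (EFin \o K).
  by rewrite -restrict_EFin; exact: (integrable_mkcond _ mI).1 ik.
have iKS (D : set (measurableTypeR R)) : measurable D -> mu.-integrable D (EFin \o K).
  by move=> mD; exact: integrableS iK.
have wK : {ae mu, forall x, l < x < u -> derive1 w x = K x}.
  by apply: filterS wk => x wx xlu; rewrite wx // /K patchE mem_set.
have incr x y : l < x -> x < y -> y < u ->
    w y - w x = (\int[mu]_(t in `]x, y]) K t)%R.
  move=> lx xy yu; have acxy := acw _ _ lx xy yu.
  have iKxy : mu.-integrable `]x, y] (EFin \o K) by apply: iKS; exact: measurable_itv.
  apply/eqP; rewrite eq_le; apply/andP; split.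
    apply: abs_cont_increment_le => //; apply: filterS wK => t wt tx _.
    by have /andP[? ?] := tx; rewrite wt // (lt_trans lx) // (lt_trans _ yu).
  apply: abs_cont_increment_ge => //; apply: filterS wK => t wt tx _.
  by have /andP[? ?] := tx; rewrite wt // (lt_trans lx) // (lt_trans _ yu).
pose F x := (\int[mu]_(t in `]l, x]) K t)%R.
have incrF x y : l < x -> x <= y -> F y - F x = (\int[mu]_(t in `]x, y]) K t)%R.
  move=> lx xy; have iK' : mu.-integrable [set` Interval (BRight l) (BRight y)] (EFin \o K).
    by apply: iKS; exact: measurable_itv.
  exact: (@Rintegral_itvB _ K (BRight l) (BRight y) x iK'
    ltac:(by rewrite bnd_simp ltW) ltac:(by rewrite bnd_simp)).
(* The primitive from [l], with its constant fixed by agreement with [w] at [m]. *)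
exists (fun x => w m - F m + F x).
  have acF : abs_cont l u F by exact: abs_cont_integral.
  apply: (@abs_cont_dominated _ _ _ F F _ 1) => // x y _ _ _.
  by rewrite mul1r opprD addrACA subrr add0r lerDl.
move=> x /andP[lx xu]; have [xm|mx|->] := ltgtP x m.
- have := incr _ _ lx xm mlu; rewrite -incrF //; last exact: ltW.
  by move=> ?; lra.
- have := incr _ _ lm mx xu; rewrite -incrF //; last exact: ltW.
  by move=> ?; lra.
- by ring.
Qed.

End extension.

(** * Reduction to real and imaginary parts *)

Section components.
Context {R : realType}.
Local Notation mu := (@lebesgue_measure R).
Local Open Scope classical_set_scope.

Definition square_integrable (f : R -> R) :=
  measurable_fun (@Ipi R) f /\
  mu.-integrable (@Ipi R) (EFin \o (fun x => f x ^+ 2)).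

Lemma L2P (f : cfun R) :
  L2 f <-> square_integrable (cre f) /\ square_integrable (cim f).
Proof.
have mI : measurable (@Ipi R : set (measurableTypeR R)) by exact: measurable_itv.
have norm2 (u : R -> R) : (fun x => `|(u x ^+ 2)%:E|%E) = (fun x => (u x ^+ 2)%:E).
  by apply/funext => x; rewrite gee0_abs // lee_fin sqr_ge0.
split=> [[mre [mim fin]]|[[mre ire] [mim iim]]].
  have m2 (u : R -> R) : measurable_fun (@Ipi R) u ->
      measurable_fun (@Ipi R) (EFin \o (fun x => u x ^+ 2)).
    by move=> mu_; apply/measurable_EFinP; exact: measurable_funX.
  have msum : measurable_fun (@Ipi R) (fun x => (cre f x ^+ 2 + cim f x ^+ 2)%:E).
    apply/measurable_EFinP; apply: measurable_funD; exact: measurable_funX.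
  split; split => //; apply/integrableP; split; try exact: m2.
    rewrite [X in (\int[mu]_(x in _) X x)%E](norm2 (cre f)).
    apply: le_lt_trans fin; apply: ge0_le_integral => //; try exact: m2.
    - by move=> x _; rewrite lee_fin sqr_ge0.
    - by move=> x _; rewrite lee_fin lerDl sqr_ge0.
  rewrite [X in (\int[mu]_(x in _) X x)%E](norm2 (cim f)).
  apply: le_lt_trans fin; apply: ge0_le_integral => //; try exact: m2.
  - by move=> x _; rewrite lee_fin sqr_ge0.
  - by move=> x _; rewrite lee_fin lerDr sqr_ge0.
split => //; split => //; exact: integrable_lty (integrableD mI ire iim).
Qed.

Lemma square_integrable_integrable (f : R -> R) : square_integrable f ->
  mu.-integrable (@Ipi R) (EFin \o f).
Proof.
move=> [mf if2]; have mI : measurable (@Ipi R : set (measurableTypeR R)).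
  exact: measurable_itv.
have i1 : mu.-integrable (@Ipi R) (EFin \o cst (1 : R)).
  apply: (measurable_bounded_integrable mI); [|exact: measurable_cst|exact: bounded_cst].
  by rewrite [ltLHS]lebesgue_measure_itv /=; case: ifP => // _; rewrite -EFinB ltry.
apply: le_integrable (integrableD mI i1 if2) => //; first exact/measurable_EFinP.
move=> x _ /=; rewrite lee_fin [leRHS]ger0_norm ?addr_ge0 ?sqr_ge0 //.
(* The interval has finite length, so the domination of the absolute value of [f] by [1 + f ^+ 2]
   suffices. *)
rewrite -real_normK ?num_real //; have := sqr_ge0 (`|f x| - 1).
have := normr_ge0 (f x); move: `|f x| => r; rewrite sqrrB expr1n mulr1 mulr2n.
by move=> *; lra.
Qed.

(** The coefficients [eps] and [sin] are real, so the complex equation splits into two real ones.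
    Each of them is treated here, from the data of [graph_L] to those of [graph_MS]. *)
Lemma quotient_component (eps : R) (z w g : R -> R) : 0 < eps < 2 ->
  abs_cont (- pi) pi z -> loc_abs_cont (- pi) pi w -> square_integrable g ->
  {ae mu, forall x, Ipi x -> w x = sin x * derive1 z x} ->
  {ae mu, forall x, Ipi x -> g x = eps * derive1 w x + derive1 z x} ->
  exists W, [/\ abs_cont (- pi) pi W, forall x, Ipi x -> W x = w x,
    square_integrable (fun x => w x / sin x) &
    {ae mu, forall x, Ipi x -> derive1 z x = w x / sin x}].
Proof.
move=> eps02 acz acw sg wE gE; have [mg ig2] := sg.
have /andP[eps0 eps2] := eps02; have pi0 := pi_gt0 R.
have mI : measurable (@Ipi R : set (measurableTypeR R)) by exact: measurable_itv.
have IpiE x : Ipi x = (- pi < x < pi) :> Prop by rewrite /Ipi /= in_itv.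
have zE : {ae mu, forall x, Ipi x -> derive1 z x = w x / sin x}.
  apply: filterS2 wE (ae_neq 0) => x wx x0 xI; rewrite wx //.
  by rewrite mulrC mulKf // sin_neq0 // -IpiE.
have so : singular_ode eps w g.
  split => //.
  - apply: (quotient_vanishes acz acw).
    by apply: filterS wE => x wx xI; apply: wx; rewrite IpiE.
  - apply: filterS2 gE zE => x gx zx xI.
    by rewrite -zx ?gx // IpiE.
have sh : square_integrable (fun x => w x / sin x).
  have mh := quotient_measurable acw.
  split => //; apply/integrableP; split.
    by apply/measurable_EFinP; exact: measurable_funX.
  apply: le_lt_trans (quotient_square_integrable eps02 so).
  rewrite le_eqVlt; apply/orP; left; apply/eqP; apply: eq_integral => x _ /=.
  by rewrite ger0_norm // sqr_ge0.
(* The derivative of [w] as read off from the equation; it is integrable because both terms are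
   square integrable on a bounded interval. *)
pose k x := eps^-1 * (g x - w x / sin x).
have ik : mu.-integrable (@Ipi R) (EFin \o k).
  have := integrableB mI (square_integrable_integrable sg) (square_integrable_integrable sh).
  by move=> /(integrableZl mI eps^-1).
have [|//||W acW WE] := @abs_cont_extension R (- pi) 0 pi w k _ _ acw ik.
- by rewrite oppr_lt0.
- apply: filterS2 gE zE => x gx zx xI.
  by rewrite /k -zx ?IpiE // gx ?IpiE // addrK mulKf // gt_eqF.
exists W; split => // x; rewrite IpiE; exact: WE.
Qed.

Lemma Ipi_derive1 (f f' : R -> R) : (forall x, Ipi x -> f x = f' x) ->
  forall x, Ipi x -> derive1 f x = derive1 f' x.
Proof.
move=> ff' x xI; rewrite !derive1E; apply: near_eq_derive.
have oI : open (@Ipi R) by exact: interval_open.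
by have := open_nbhs_nbhs (conj oI xI); apply: filterS => y; exact: ff'.
Qed.

End components.

(** * The operator identity *)

Theorem theorem1 (R : realType) (eps : R) (heps : 0 < eps < 2) :
  forall y g : cfun R, graph_L eps y g <-> graph_MS eps y g.
Proof.
move=> y g; split.
  move=> [Ly [Lg [z [zy [[acre acim] [pz [w [acw [[wre wim] [gre gim]]]]]]]]]].
  have [sgre sgim] := (L2P g).1 Lg.
  have acwre : loc_abs_cont (- pi) pi (cre w) by move=> a b pa ab bp; have [] := acw a b pa ab bp.
  have acwim : loc_abs_cont (- pi) pi (cim w) by move=> a b pa ab bp; have [] := acw a b pa ab bp.
  have [Wr [acWr Wr_w shr zr]] := quotient_component heps acre acwre sgre wre gre.
  have [Wi [acWi Wi_w shi zi]] := quotient_component heps acim acwim sgim wim gim.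
  (* The intermediate function [Sy]: it represents the derivative of [z] almost everywhere and is
     measurable by construction from [w]. *)
  pose h := CFun (fun x => cre w x / sin x) (fun x => cim w x / sin x).
  have Lh : L2 h by apply/L2P.
  exists h; split.
    by split => //; split => //; exists z.
  split => //; split => //; exists (CFun Wr Wi); split => //; split.
    split => /=.
      apply: filterS2 wre zr => x wx zx xI.
      by rewrite Wr_w //= -zx //; exact: wx.
    apply: filterS2 wim zi => x wx zx xI.
    by rewrite Wi_w //= -zx //; exact: wx.
  split => /=.
    apply: filterS2 gre zr => x gx zx xI.
    by rewrite (Ipi_derive1 Wr_w) // -zx // gx.
  apply: filterS2 gim zi => x gx zx xI.
  by rewrite (Ipi_derive1 Wi_w) // -zx // gx.
(* Conversely, the [w] of [M] is absolutely continuous on the closed interval, hence locally, and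
   [h] is replaced by the derivative of [z] almost everywhere. *)
move=> [h [[Ly [Lh [z [zy [acz [pz [zr zi]]]]]]] [_ [Lg [w [[acwr acwi] [[wr wi] [gr gi]]]]]]]].
split => //; split => //; exists z; do 3 split => //; exists w; split.
  by move=> a b pa ab bp; split; [apply: abs_contS acwr|apply: abs_contS acwi]; exact: ltW.
split; split => /=.
- by apply: filterS2 wr zr => x wx zx xI; rewrite wx //= -zx.
- by apply: filterS2 wi zi => x wx zx xI; rewrite wx //= -zx.
- by apply: filterS2 gr zr => x gx zx xI; rewrite gx //= -zx.
- by apply: filterS2 gi zi => x gx zx xI; rewrite gx //= -zx.
Qed.
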